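(* Let $1<q\le 2$ and let $E$ be a real $q$-uniformly smooth and $2$-uniformly convex Banach space with normalized duality mapping $J:E\to E^*$. Let $C$ be a nonempty closed convex subset of $E$, and let $A\subset E\times E^*$ be a monotone operator satisfying $D(A)\subset C\subset J^{-1}R(J+rA)$ for all $r>0$. Let $r$ be a positive real number and let $J_rx=(J+rA)^{-1}Jx$ for all $x\in C$. Then for every $R>0$ there is a constant $L$ such that for all $x,y\in C$ with $\|x\|\le R$ and $\|y\|\le R$, $$\|J_rx-J_ry\|\le L\,\|x-y\|^{q-1}.$$
   Context: The normalized duality mapping of $E$ is $Jx=\{x^*\in E^*:\langle x,x^*\rangle=\|x\|^2=\|x^*\|^2\}$; when $E$ is smooth (in particular $q$-uniformly smooth), $Jx$ is a singleton for every $x$ and $J$ is regarded as a map $E\to E^*$. The modulus of smoothness of $E$ is $$\rho_E(\tau)=\sup\left\{\frac{\|x+\tau y\|+\|x-\tau y\|}{2}-1:\ \|x\|=\|y\|=1\right\},$$ and $E$ is $q$-uniformly smooth ($1<q\le 2$) if there is a constant $K>0$ with $\rho_E(\tau)\le K\tau^q$ for all $\tau>0$. The modulus of convexity of $E$ is $$\delta_E(\varepsilon)=\inf\left\{1-\frac{\|x+y\|}{2}:\ \|x\|=\|y\|=1,\ \|x-y\|=\varepsilon\right\},$$ and $E$ is $2$-uniformly convex if there is a constant $c>0$ with $\delta_E(\varepsilon)\ge c\,\varepsilon^2$ for all $\varepsilon\in(0,2]$. A set $A\subset E\times E^*$ is viewed as a set-valued operator with $Ax=\{x^*:(x,x^*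 )\in A\}$ and domain $D(A)=\{x\in E: Ax\ne\emptyset\}$; it is monotone if $\langle x-y,x^*-y^*\rangle\ge 0$ for all $(x,x^* ),(y,y^* )\in A$. $R(J+rA)=\{Jz+rz^*:(z,z^* )\in A\}$ is the range of $J+rA$, and $J^{-1}R(J+rA)=\{x\in E: Jx\in R(J+rA)\}$. The resolvent value $J_rx=(J+rA)^{-1}Jx$ is the unique $z\in D(A)$ with $Jx\in Jz+rAz$; so $J_r:C\to D(A)$ is a single-valued map. *)

(* Defs.v *)
From HB Require Import structures.
From mathcomp Require Import all_boot all_order all_algebra.
From mathcomp Require Import all_classical all_reals all_analysis.

Set Implicit Arguments.
Unset Strict Implicit.
Unset Printing Implicit Defensive.

Import Order.TTheory GRing.Theory Num.Theory.
Import numFieldNormedType.Exports.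

Local Open Scope classical_set_scope.
Local Open Scope ring_scope.

Section dual_space.
Context {R : realType} (E : normedModType R).

Definition dual_pred : {pred E -> R^o} :=
  [pred f | `[< linear f /\ continuous f >]].

Record dual := Dual {
  dual_fun :> E -> R^o;
  dual_funP : dual_fun \in dual_pred }.

HB.instance Definition _ := [isSub for dual_fun].
HB.instance Definition _ := [Choice of dual by <:].

Lemma dual_submod_closed : submod_closed dual_pred.
Proof.
split.
  apply/asboolP; split; last by move=> x; exact: cvg_cst.
  by move=> a x y; rewrite scaler0 addr0.
move=> a f g /asboolP[lf cf] /asboolP[lg cg]; apply/asboolP; split.
  move=> b x y; rewrite !fctE lf lg !scalerDr !scalerA addrACA.
  by rewrite (mulrC a b).
move=> x; rewrite [X in continuous_at _ X](_ : _ = (fun z => a *: f z + g z)) //.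
by apply: cvgD; [apply: cvgZr; exact: cf | exact: cg].
Qed.

HB.instance Definition _ :=
  GRing.isSubmodClosed.Build R (E -> R^o) dual_pred dual_submod_closed.
HB.instance Definition _ := [SubChoice_isSubLmodule of dual by <:].

Definition pairing (x : E) (xs : dual) : R := xs x.

Definition dual_norm (xs : dual) : R :=
  sup [set `|pairing x xs| | x in [set x : E | `|x| <= 1]].

End dual_space.

Section geometry.
Context {R : realType} (E : normedModType R).

(* The supremum and infimum are taken in \bar R, so that the infimum over an
   empty set (which occurs when dim E <= 1) is +oo and not 0. *)
Definition modulus_smoothness (tau : R) : \bar R :=
  ereal_sup [set u | exists x y : E, [/\ `|x| = 1, `|y| = 1 &
    u = ((`|x + tau *: y| + `|x - tau *: y|) / 2 - 1)%:E]].

Definition uniformly_smooth (q : R) :=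
  exists2 K : R, 0 < K &
    forall tau, 0 < tau -> (modulus_smoothness tau <= (K * tau `^ q)%:E)%E.

Definition modulus_convexity (eps : R) : \bar R :=
  ereal_inf [set u | exists x y : E, [/\ `|x| = 1, `|y| = 1, `|x - y| = eps &
    u = (1 - `|x + y| / 2)%:E]].

Definition two_uniformly_convex :=
  exists2 c : R, 0 < c &
    forall eps, 0 < eps -> eps <= 2 ->
      ((c * eps ^+ 2)%:E <= modulus_convexity eps)%E.

Definition duality_set (x : E) : set (dual E) :=
  [set xs | pairing x xs = `|x| ^+ 2 /\ `|x| ^+ 2 = dual_norm xs ^+ 2].

(* The element of duality_set x, which is a singleton when E is smooth; the
   default value 0 is only for an empty duality_set x, which never occurs. *)
Definition duality_map (x : E) : dual E := xget 0 (duality_set x).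

End geometry.

Section operators.
Context {R : realType} (E : normedModType R).
Implicit Types (A : set (E * dual E)) (r : R) (x : E).
Local Notation J := (@duality_map R E).

Definition op_domain A : set E := [set x | exists xs, A (x, xs)].

Definition monotone_op A :=
  forall x xs y ys, A (x, xs) -> A (y, ys) -> 0 <= pairing (x - y) (xs - ys).

Definition range_J_plus A r : set (dual E) :=
  [set J p.1 + r *: p.2 | p in A].

Definition resolvent_set A r x : set E :=
  [set z | exists2 zs, A (z, zs) & J x = J z + r *: zs].

(* The element of resolvent_set A r x, for J x in range_J_plus A r. *)
Definition resolvent A r x : E := xget 0 (resolvent_set A r x).

End operators.

(* Main.v *)
(** For [u = J_r x] and [v = J_r y], monotonicity of [A] gives
    [<u - v, Ju - Jv> <= <u - v, Jx - Jy>].  2-uniform convexity bounds the left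
    side below by a multiple of [|u - v|^2], for all [u] and [v]: no bound on the
    resolvents is needed.  q-uniform smoothness makes [J] Hoelder continuous of
    exponent [q - 1] on bounded sets, which bounds the right side above by a
    multiple of [|u - v| |x - y|^(q-1)].

    The existence of duality functionals does not need the Hahn-Banach theorem
    here: in a smooth space the one-sided directional derivative of the norm at
    [x <> 0] is linear, and [|x|] times it belongs to [duality_set x]. *)
From HB Require Import structures.
Require Import Defs.
From mathcomp Require Import all_boot all_order all_algebra.
From mathcomp Require Import all_classical all_reals all_analysis.
From mathcomp Require Import ring lra.

Set Implicit Arguments.
Unset Strict Implicit.
Unset Printing Implicit Defensive.

Import Order.TTheory GRing.Theory Num.Theory.
Import numFieldNormedType.Exports.

Local Open Scope classical_set_scope.
Local Open Scope ring_scope.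

(** * The one-sided directional derivative of the norm *)

Section norm_derivative.
Context {R : realType} (E : normedModType R).
Implicit Types (x y z : E) (s t m : R).

Definition norm_quot x y t : R := (`|x + t *: y| - `|x|) / t.

(* Difference quotients of a convex function are monotone, so the infimum is the
   one-sided derivative at [0] of [t |-> |x + t y|]. *)
Definition norm_deriv x y : R :=
  inf [set norm_quot x y t | t in [set t : R | 0 < t]].

Lemma norm_quot_ge x y t : 0 < t -> - `|y| <= norm_quot x y t.
Proof.
move=> t0; rewrite ler_pdivlMr//.
have := ler_normB (x + t *: y) (t *: y).
rewrite addrK normrZ gtr0_norm// mulrC; lra.
Qed.

Lemma norm_quot_le x y t : 0 < t -> norm_quot x y t <= `|y|.
Proof.
move=> t0; rewrite ler_pdivrMr//.
have := ler_normD x (t *: y).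
rewrite normrZ gtr0_norm// mulrC; lra.
Qed.

Lemma norm_deriv_le_quot x y t : 0 < t -> norm_deriv x y <= norm_quot x y t.
Proof.
move=> t0; apply: ge_inf; last by exists t.
by exists (- `|y|) => _ [s s0 <-]; exact: norm_quot_ge.
Qed.

Lemma le_norm_deriv x y m :
  (forall t, 0 < t -> m <= norm_quot x y t) -> m <= norm_deriv x y.
Proof.
move=> le_m; apply: lb_le_inf; first by exists (norm_quot x y 1), 1 => //=.
by move=> _ [t t0 <-]; exact: le_m.
Qed.

Lemma norm_deriv_norm x y : `|norm_deriv x y| <= `|y|.
Proof.
rewrite ler_norml le_norm_deriv /=; last by move=> t; exact: norm_quot_ge.
by apply: le_trans (norm_quot_le x y ltr01); exact: norm_deriv_le_quot.
Qed.

Lemma norm_deriv_self x : norm_deriv x x = `|x|.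
Proof.
have quotE t : 0 < t -> norm_quot x x t = `|x|.
  move=> t0; rewrite /norm_quot -{1}[x]scale1r -scalerDl normrZ gtr0_norm; last lra.
  by field; rewrite gt_eqF.
apply/le_anti/andP; split; first by rewrite -(quotE 1)// norm_deriv_le_quot.
by apply: le_norm_deriv => t t0; rewrite quotE.
Qed.

Lemma norm_deriv0 x : norm_deriv x 0 = 0.
Proof. by apply/eqP; rewrite -normr_le0 (le_trans (norm_deriv_norm x 0))// normr0. Qed.

Lemma norm_derivZ_le x y t : 0 < t -> norm_deriv x (t *: y) <= t * norm_deriv x y.
Proof.
move=> t0; rewrite -ler_pdivrMl//; apply: le_norm_deriv => s s0.
rewrite ler_pdivrMl//.
have st0 : 0 < s / t by rewrite divr_gt0.
apply: (le_trans (norm_deriv_le_quot x (t *: y) st0)).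
rewrite /norm_quot scalerA divfK ?gt_eqF// le_eqVlt; apply/orP; left; apply/eqP.
by field; rewrite !gt_eqF.
Qed.

Lemma norm_derivZ_gt0 x y t : 0 < t -> norm_deriv x (t *: y) = t * norm_deriv x y.
Proof.
move=> t0; apply/le_anti; rewrite norm_derivZ_le//=.
have ti0 : 0 < t^-1 by rewrite invr_gt0.
have := norm_derivZ_le x (t *: y) ti0.
by rewrite scalerA mulVf ?gt_eqF// scale1r ler_pdivlMl.
Qed.

(** With [u = s t / (s + t)], the point [x + u (y + z)] is the convex combination of [x + s y] and
    [x + t z] with weights [t / (s + t)] and [s / (s + t)]. Convexity of the norm bounds the
    quotient at [u] by the sum of the quotients at [s] and [t], and [s] and [t] vary
    independently. *)
Lemma norm_deriv_subadd x y z :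
  norm_deriv x (y + z) <= norm_deriv x y + norm_deriv x z.
Proof.
rewrite -lerBlDr; apply: le_norm_deriv => s s0.
rewrite lerBlDl -lerBlDr; apply: le_norm_deriv => t t0.
have st0 : 0 < s + t by rewrite addr_gt0.
have u0 : 0 < s * t / (s + t) by rewrite divr_gt0// mulr_gt0.
rewrite lerBlDl; apply: (le_trans (norm_deriv_le_quot x (y + z) u0)).
rewrite /norm_quot.
have -> : x + (s * t / (s + t)) *: (y + z) =
    (s + t)^-1 *: (t *: (x + s *: y) + s *: (x + t *: z)).
  rewrite !scalerDr !scalerA addrACA -!scalerDl.
  have -> : (s + t)^-1 * t + (s + t)^-1 * s = 1 by field; rewrite gt_eqF.
  by rewrite scale1r; congr (_ + (_ *: _ + _ *: _)); field; rewrite gt_eqF.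
have le_N : `|(s + t)^-1 *: (t *: (x + s *: y) + s *: (x + t *: z))| <=
    (s + t)^-1 * (t * `|x + s *: y| + s * `|x + t *: z|).
  rewrite normrZ gtr0_norm ?invr_gt0// ler_pM2l ?invr_gt0//.
  by rewrite (le_trans (ler_normD _ _))// !normrZ !gtr0_norm.
rewrite ler_pdivrMr// lerBlDr (le_trans le_N)// le_eqVlt; apply/orP; left.
by apply/eqP; field; rewrite !gt_eqF.
Qed.

End norm_derivative.

(** Used to discard a remainder of order [q > 1]. If [e > 0], then at the [t] with
    [t^(q-1) = e / (c + 1)] one gets [c t^q < e t]; the [+ 1] covers [c = 0]. *)
Lemma le0_of_le_powR (R : realType) (q e c : R) : 1 < q -> 0 <= c ->
  (forall t, 0 < t -> e * t <= c * t `^ q) -> e <= 0.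
Proof.
move=> q1 c0 le_e; rewrite leNgt; apply/negP => e0.
have z0 : 0 < e / (c + 1) by rewrite divr_gt0//; lra.
set t := (e / (c + 1)) `^ (q - 1)^-1.
have t0 : 0 < t by rewrite powR_gt0.
have tq : t `^ q = e / (c + 1) * t.
  rewrite -[q in LHS](subrK 1) powRD; last by rewrite (gt_eqF t0) implybT.
  rewrite powRr1 ?ltW// -powRrM mulVf ?powRr1 ?ltW//.
  by rewrite gt_eqF// subr_gt0.
have := le_e t t0; rewrite tq mulrA ler_pM2r// mulrCA ler_pMr//.
by rewrite ler_pdivlMr; lra.
Qed.

(** * Smoothness makes the directional derivative linear *)

Section smooth_space.
Context {R : realType} (E : normedModType R).
Implicit Types (x y z h w : E) (q K : R).

(** The bound on the modulus of smoothness at [tau = |h| / |x|], multiplied by [2 |x|] so that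
    neither vector has to be normalized; [K] absorbs the factor 2. *)
Definition smooth_bound q K := forall x h, x != 0 ->
  `|x + h| + `|x - h| <= 2 * `|x| + K * `|x| * (`|h| / `|x|) `^ q.

Lemma uniformly_smooth_bound q :
  uniformly_smooth E q -> exists2 K, 0 < K & smooth_bound q K.
Proof.
move=> [K K0 rhoK]; exists (2 * K) => [|x h x0]; first by rewrite mulr_gt0.
have nx0 : 0 < `|x| by rewrite normr_gt0.
have [->|h0] := eqVneq h 0.
  rewrite addr0 subr0 mulrDl !mul1r lerDl.
  by rewrite !mulr_ge0 ?powR_ge0// ltW.
have nh0 : 0 < `|h| by rewrite normr_gt0.
have tau0 : 0 < `|h| / `|x| by rewrite divr_gt0.
have := rhoK _ tau0; rewrite /modulus_smoothness; set t := `|h| / `|x| => le_rho.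
have th : t *: (`|h|^-1 *: h) = `|x|^-1 *: h.
  by rewrite scalerA /t mulrAC divff ?gt_eqF// mul1r.
have : (((`|(`|x|^-1 *: x + t *: (`|h|^-1 *: h))| +
           `|(`|x|^-1 *: x - t *: (`|h|^-1 *: h))|) / 2 - 1)%:E <=
         (K * t `^ q)%:E)%E.
  apply: le_trans le_rho; apply: ereal_sup_ubound.
  exists (`|x|^-1 *: x), (`|h|^-1 *: h).
  by split=> //; rewrite normrZ normfV normr_id mulVf ?gt_eqF.
rewrite lee_fin th -scalerDr -scalerBr !normrZ normfV normr_id -mulrDr => le_K.
rewrite -(ler_pM2l (_ : 0 < `|x|^-1)) ?invr_gt0//.
have -> : `|x|^-1 * (2 * `|x| + 2 * K * `|x| * t `^ q) = 2 + 2 * (K * t `^ q).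
  by field; rewrite gt_eqF.
lra.
Qed.

Variables (q K : R).
Hypotheses (q_gt1 : 1 < q) (K_ge0 : 0 <= K) (smoothE : smooth_bound q K).

(** The sum of the derivatives along [y] and [-y] is nonnegative by subadditivity. Smoothness with
    [h = t y] bounds [t] times this sum by a multiple of [t^q] for all [t > 0], so the sum is also
    nonpositive. *)
Lemma norm_deriv_opp x y : x != 0 -> norm_deriv x (- y) = - norm_deriv x y.
Proof.
move=> x0; apply/eqP; rewrite -addr_eq0 eq_le; apply/andP; split; last first.
  by rewrite -(norm_deriv0 x) -(addNr y) norm_deriv_subadd.
have nx0 : 0 < `|x| by rewrite normr_gt0.
apply: (@le0_of_le_powR _ q _ (K * `|x| * (`|y| / `|x|) `^ q)) => //.
  by rewrite !mulr_ge0// powR_ge0.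
move=> t t0; rewrite -ler_pdivlMr//.
apply: (le_trans (lerD (norm_deriv_le_quot x _ t0) (norm_deriv_le_quot x _ t0))).
rewrite /norm_quot -mulrDl ler_pM2r ?invr_gt0//.
have := smoothE (t *: y) x0; rewrite scalerN normrZ gtr0_norm//.
have -> : (t * `|y| / `|x|) `^ q = (`|y| / `|x|) `^ q * t `^ q.
  by rewrite -powRM ?divr_ge0// ?(ltW t0)// [_ * t]mulrC mulrA.
lra.
Qed.

Lemma norm_derivD x y z : x != 0 ->
  norm_deriv x (y + z) = norm_deriv x y + norm_deriv x z.
Proof.
move=> x0; apply/le_anti; rewrite norm_deriv_subadd /=.
have := norm_deriv_subadd x (y + z) (- z).
by rewrite addrK norm_deriv_opp//; lra.
Qed.

Lemma norm_derivZ x y t : x != 0 -> norm_deriv x (t *: y) = t * norm_deriv x y.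
Proof.
move=> x0; have [t0|t0|<-] := ltgtP 0 t.
- exact: norm_derivZ_gt0.
- rewrite -[t]opprK scaleNr norm_deriv_opp// norm_derivZ_gt0 ?oppr_gt0//.
  exact/esym/mulNr.
- by rewrite scale0r norm_deriv0 mul0r.
Qed.

End smooth_space.

(** * The pairing, the dual norm and the existence of duality functionals *)

Section duality.
Context {R : realType} (E : normedModType R).
Implicit Types (x y z : E) (xs ys : dual E).

Lemma pairing_linear xs : linear ((fun x => pairing x xs) : E -> R^o).
Proof. by have /asboolP[] := dual_funP xs. Qed.

Lemma pairingDl xs x y : pairing (x + y) xs = pairing x xs + pairing y xs.
Proof. by have := pairing_linear xs 1 x y; rewrite !scale1r. Qed.

Lemma pairingZl xs t x : pairing (t *: x) xs = t * pairing x xs.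
Proof.
have p0 : pairing 0 xs = 0.
  by have := pairingDl xs 0 0; rewrite addr0; lra.
by have := pairing_linear xs t x 0; rewrite !addr0 p0 addr0.
Qed.

Lemma pairingNl xs x : pairing (- x) xs = - pairing x xs.
Proof. by rewrite -scaleN1r pairingZl mulN1r. Qed.

Lemma pairingBl xs x y : pairing (x - y) xs = pairing x xs - pairing y xs.
Proof. by rewrite pairingDl pairingNl. Qed.

Lemma pairingNr xs x : pairing x (- xs) = - pairing x xs.
Proof. by []. Qed.

Lemma pairingZr xs t x : pairing x (t *: xs) = t * pairing x xs.
Proof. by []. Qed.

Lemma pairingBr xs ys x : pairing x (xs - ys) = pairing x xs - pairing x ys.
Proof. by []. Qed.

Lemma dual_bounded (f : E -> R^o) : linear f ->
  (exists M, forall x, `|f x| <= M * `|x|) <-> continuous f.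
Proof.
move=> lf.
pose F : {linear E -> R^o} := HB.pack f (GRing.isLinear.Build _ _ _ _ f lf).
rewrite -(linear_bounded_continuous F) linear_boundedP.
split=> [[M fM]|].
  apply: filterS (nbhs_pinfty_ge (num_real M)) => k Mk x.
  by rewrite (le_trans (fM x))// ler_wpM2r.
by move=> /pinfty_ex_gt0[M _ fM]; exists M.
Qed.

Lemma dual_norm_has_sup xs :
  has_sup [set `|pairing x xs| | x in [set x : E | `|x| <= 1]].
Proof.
split; first by exists `|pairing 0 xs|, 0 => //=; rewrite normr0.
have /asboolP[lf /(dual_bounded lf)[M fM]] := dual_funP xs.
exists `|M| => _ [x x1 <-]; apply: (le_trans (fM x)).
apply: (le_trans (ler_norm _)); rewrite normrM normr_id.
exact: ler_piMr.
Qed.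

Lemma dual_norm_ge0 xs : 0 <= dual_norm xs.
Proof.
apply: (@le_trans _ _ `|pairing 0 xs|) => //.
apply: ub_le_sup; first by case: (dual_norm_has_sup xs).
by exists 0 => //=; rewrite normr0.
Qed.

Lemma pairing_le_dual_norm xs x : `|pairing x xs| <= dual_norm xs * `|x|.
Proof.
have [->|x0] := eqVneq x 0.
  by rewrite -(scale0r 0) pairingZl mul0r !normr0 scale0r normr0 mulr0.
have nx0 : 0 < `|x| by rewrite normr_gt0.
rewrite -ler_pdivrMr//; apply: ub_le_sup; first by case: (dual_norm_has_sup xs).
exists (`|x|^-1 *: x) => /=.
  by rewrite normrZ normfV normr_id mulVf ?gt_eqF.
by rewrite pairingZl normrM normfV normr_id mulrC.
Qed.

(** Trades the supremum in [dual_norm] for a pointwise bound. In the converse direction the value at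
    [x] itself forces [dual_norm xs] to be at least [|x|]. *)
Lemma duality_setP x xs : duality_set x xs <->
  pairing x xs = `|x| ^+ 2 /\ forall y, `|pairing y xs| <= `|x| * `|y|.
Proof.
split=> [[-> /eqP]|[xx le_x]].
  rewrite eqrXn2 ?dual_norm_ge0// => /eqP->; split=> // y.
  exact: pairing_le_dual_norm.
split=> //; congr (_ ^+ 2); apply/le_anti/andP; split; last first.
  apply: ge_sup; first by case: (dual_norm_has_sup xs).
  by move=> _ [y y1 <-]; rewrite (le_trans (le_x y))// ler_piMr.
have [->|x0] := eqVneq x 0; first by rewrite normr0 dual_norm_ge0.
have nx0 : 0 < `|x| by rewrite normr_gt0.
rewrite -(ler_pM2r nx0) -expr2 -xx.
exact: le_trans (ler_norm _) (pairing_le_dual_norm _ _).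
Qed.

Lemma duality_set_neq0 q K : 1 < q -> 0 <= K -> smooth_bound E q K ->
  forall x, duality_set x !=set0.
Proof.
move=> q1 K0 smoothE x; have [->|x0] := eqVneq x 0.
  by exists 0; apply/duality_setP; rewrite !normr0 expr2 mul0r; split=> // y;
    rewrite mul0r normr0.
pose f : E -> R^o := fun y => `|x| * norm_deriv x y.
have lf : linear f.
  move=> t y z; rewrite /f (norm_derivD q1 K0 smoothE)//.
  by rewrite (norm_derivZ q1 K0 smoothE)// mulrDr mulrCA.
have f_le y : `|f y| <= `|x| * `|y|.
  by rewrite /f normrM normr_id ler_wpM2l// norm_deriv_norm.
have fD : f \in @dual_pred R E.
  by apply/asboolP; split=> //; apply/(dual_bounded lf); exists `|x|.
exists (Dual fD); apply/duality_setP; split=> //.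
by rewrite /pairing /= /f norm_deriv_self expr2.
Qed.

End duality.

(** * Hoelder continuity of the duality map on bounded sets *)

Section duality_holder.
Context {R : realType} (E : normedModType R).
Implicit Types (x y z w : E) (xs ys jx jy : dual E) (q K rho : R).

(* Smoothness at [x] in the direction [h = y - x + w], bounding [|x + h|] below by
   [jy] and [|x - h|] by [jx]. *)
Lemma norming_diff_le q K x y w jx jy : smooth_bound E q K -> x != 0 ->
  (forall z, `|pairing z jx| <= `|z|) -> pairing x jx = `|x| ->
  (forall z, `|pairing z jy| <= `|z|) -> pairing y jy = `|y| ->
  pairing w (jy - jx) <= K * `|x| * (`|y - x + w| / `|x|) `^ q.
Proof.
move=> smoothE x0 jx1 jxx jy1 jyy; have := smoothE x (y - x + w) x0.
have := le_trans (ler_norm _) (jy1 (x + (y - x + w))).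
have := le_trans (ler_norm _) (jx1 (x - (y - x + w))).
have := le_trans (ler_norm _) (jx1 y).
rewrite !(pairingDl, pairingNl) pairingBr jxx jyy.
lra.
Qed.

(* For [y = 0] the junk value [0^-1 = 0] gives [jy = 0], as wanted. *)
Lemma norming_of_duality y ys : duality_set y ys ->
  let jy := `|y|^-1 *: ys in
  [/\ forall z, `|pairing z jy| <= `|z|, pairing y jy = `|y| &
      forall z, pairing z ys = `|y| * pairing z jy].
Proof.
move=> /duality_setP[yy le_y] jy; rewrite /jy.
have [y0|y0] := eqVneq y 0.
  rewrite y0 normr0 invr0; split=> [z||z]; rewrite pairingZr mul0r ?normr0//.
  apply/eqP; rewrite -normr_le0 (le_trans (le_y z))//.
  by rewrite y0 normr0 mul0r.
have ny0 : 0 < `|y| by rewrite normr_gt0.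
split=> [z||z]; rewrite pairingZr.
- by rewrite normrM normfV normr_id ler_pdivrMl.
- by rewrite yy expr2 mulKf ?gt_eqF.
- by rewrite mulVKf ?gt_eqF.
Qed.

(** With the normalized functionals [jx], [jy], write [xs - ys = |x| (jx - jy) + (|x| - |y|) jy].
    The two summands give the two terms of the constant: smoothness controls the first, the reverse
    triangle inequality the second. *)
Lemma duality_holder q K rho x y z xs ys :
  1 < q -> q <= 2 -> 0 <= K -> smooth_bound E q K ->
  x != y -> `|x| <= rho -> `|y| <= rho -> `|z| <= 1 ->
  duality_set x xs -> duality_set y ys ->
  pairing z (xs - ys) <=
    (K * 2 `^ q * rho `^ (2 - q) + (2 * rho) `^ (2 - q)) * `|x - y| `^ (q - 1).
Proof.
move=> q1 q2 K0 smoothE xy xr yr z1 Jx Jy.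
have rho0 : 0 <= rho by apply: le_trans xr.
set t := `|x - y|; have t0 : 0 < t by rewrite normr_gt0 subr_eq0.
have tS (p : R) : t `^ p = t `^ (p - 1) * t.
  rewrite -{3}[t]powRr1 ?ltW// -powRD ?subrK//.
  by rewrite (gt_eqF t0) implybT.
(* The Lipschitz term is brought to exponent [q - 1] by [t <= 2 rho], using [q <= 2]. *)
have t_le : t <= (2 * rho) `^ (2 - q) * t `^ (q - 1).
  have {1}-> : t = t `^ (2 - q) * t `^ (q - 1).
    rewrite -powRD; last by rewrite (gt_eqF t0) implybT.
    by rewrite -[LHS]powRr1 ?ltW//; congr (_ `^ _); lra.
  rewrite ler_wpM2r ?powR_ge0// ge0_ler_powR ?nnegrE ?subr_ge0 ?mulr_ge0 ?(ltW t0)//.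
  by rewrite /t (le_trans (ler_normB _ _))//; lra.
rewrite mulrDl.
have [jx1 jxx xsE] := norming_of_duality Jx.
have [jy1 jyy ysE] := norming_of_duality Jy.
move: (_ *: xs) (_ *: ys) jx1 jxx xsE jy1 jyy ysE => jx jy jx1 jxx xsE jy1 jyy ysE.
have jyz : `|(`|x| - `|y|) * pairing z jy| <= t.
  rewrite normrM -[t]mulr1; apply: ler_pM => //; first exact: ler_dist_dist.
  exact: le_trans (jy1 z) z1.
rewrite pairingBr xsE ysE.
have -> : `|x| * pairing z jx - `|y| * pairing z jy =
  `|x| * pairing z (jx - jy) + (`|x| - `|y|) * pairing z jy.
  by rewrite pairingBr; ring.
apply: lerD; last exact: le_trans (ler_norm _) (le_trans jyz t_le).
have [->|x0] := eqVneq x 0.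
  by rewrite normr0 mul0r !mulr_ge0// powR_ge0.
have nx0 : 0 < `|x| by rewrite normr_gt0.
(* Scaling [z] by [t = |x - y|] keeps the increment within [2 t]; dividing the resulting [t^q] by
   [t] leaves the exponent [q - 1]. *)
have := norming_diff_le (- (t *: z)) smoothE x0 jx1 jxx jy1 jyy.
rewrite pairingNl pairingZl -mulrN -pairingNr opprB => le_D.
have le_2t : `|y - x - t *: z| <= 2 * t.
  rewrite (le_trans (ler_normB _ _))// normrZ gtr0_norm// distrC -/t.
  by have := ler_pM2l t0 `|z| 1; rewrite z1; lra.
have {}le_D : t * pairing z (jx - jy) <= K * `|x| * (2 * t / `|x|) `^ q.
  apply: (le_trans le_D); rewrite ler_wpM2l ?mulr_ge0//.
  apply: ge0_ler_powR; rewrite ?nnegrE ?divr_ge0 ?mulr_ge0 ?(ltW t0)//.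
    by rewrite (le_trans ler01)// ltW.
  by rewrite ler_pM2r ?invr_gt0.
(* The outer factor [|x|] turns the singular [|x|^(1-q)] into [|x|^(2-q)], which stays bounded near
   [x = 0]. *)
have powE : `|x| * `|x| * (2 * t / `|x|) `^ q =
    `|x| `^ (2 - q) * 2 `^ q * t `^ (q - 1) * t.
  have -> : `|x| * `|x| = `|x| `^ (2 - q) * `|x| `^ q.
    rewrite -powRD; last by rewrite (gt_eqF nx0) implybT.
    by rewrite subrK powR_mulrn.
  rewrite -[LHS]mulrA -powRM ?divr_ge0 ?mulr_ge0 ?(ltW t0)//.
  rewrite [`|x| * (_ / _)]mulrC divfK ?gt_eqF// powRM ?(ltW t0)// tS; ring.
have x_rho : `|x| `^ (2 - q) <= rho `^ (2 - q).
  by rewrite ge0_ler_powR ?nnegrE ?subr_ge0.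
have pow0 : 0 <= K * (2 `^ q * t `^ (q - 1) * t).
  by rewrite !mulr_ge0 ?powR_ge0// ltW.
rewrite -(ler_pM2r t0).
have := ler_wpM2l pow0 x_rho; have := ler_wpM2l (ltW nx0) le_D.
have := congr1 (fun u => K * u) powE => /=; lra.
Qed.

End duality_holder.

(** * Strong monotonicity of the duality map from 2-uniform convexity *)

Section strong_monotonicity.
Context {R : realType} (E : normedModType R).
Implicit Types (x y : E) (xs ys : dual E).

Lemma two_uniformly_convex_unit : two_uniformly_convex E ->
  exists2 c, 0 < c & forall x y, `|x| = 1 -> `|y| = 1 ->
    `|x + y| <= 2 - c * `|x - y| ^+ 2.
Proof.
move=> [c c0 le_delta]; exists (2 * c) => [|x y x1 y1]; first by rewrite mulr_gt0.
have le2 : `|x + y| <= 2 by rewrite (le_trans (ler_normD _ _))// x1 y1.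
have [xy|xy] := eqVneq x y.
  by move: le2; rewrite xy subrr normr0 expr0n mulr0 subr0.
have xy0 : 0 < `|x - y| by rewrite normr_gt0 subr_eq0.
have xy2 : `|x - y| <= 2 by rewrite (le_trans (ler_normB _ _))// x1 y1.
have : ((c * `|x - y| ^+ 2)%:E <= (1 - `|x + y| / 2)%:E)%E.
  apply: (le_trans (le_delta _ xy0 xy2)); apply: ereal_inf_lbound.
  by exists x, y.
by rewrite lee_fin; lra.
Qed.

Lemma two_uniformly_convex_parallelogram : two_uniformly_convex E ->
  exists2 k, 0 < k & forall x y,
    `|x + y| ^+ 2 + k * `|x - y| ^+ 2 <= 2 * `|x| ^+ 2 + 2 * `|y| ^+ 2.
Proof.
move=> /two_uniformly_convex_unit[c c0 unit_le].
(* In the final sum, [k <= c] absorbs the term in [(b e)^2] and [k <= 1/2] the term in [(a - b)^2],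
   leaving [(a + b)^2 + (a - b)^2 = 2 a^2 + 2 b^2]. *)
pose k := Num.min c (2^-1).
have k0 : 0 < k by rewrite lt_min c0 invr_gt0 ltr0n.
have kc : k <= c by rewrite ge_min lexx.
have k2 : k <= 2^-1 by rewrite ge_min lexx orbT.
exists k => // x y.
(* Compare [x = |y| x' + (|x| - |y|) x'] and [y = |y| y'] with unit [x'], [y']. *)
wlog yx : x y / `|y| <= `|x|.
  move=> wl; have [/wl//|/ltW/wl le_yx] := leP `|y| `|x|.
  by rewrite addrC distrC [leRHS]addrC [x + y]addrC [leLHS]addrC.
have [y0|y0] := eqVneq y 0.
  rewrite y0 addr0 subr0 normr0 expr0n mulr0 addr0.
  have := sqr_ge0 `|x|; nra.
have b0 : 0 < `|y| by rewrite normr_gt0.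
have a0 : 0 < `|x| by apply: lt_le_trans yx.
pose x' := `|x|^-1 *: x; pose y' := `|y|^-1 *: y.
have x'1 : `|x'| = 1 by rewrite normrZ normfV normr_id mulVf ?gt_eqF.
have y'1 : `|y'| = 1 by rewrite normrZ normfV normr_id mulVf ?gt_eqF.
have xE : x = `|y| *: x' + (`|x| - `|y|) *: x'.
  by rewrite -scalerDl addrC subrK /x' scalerA mulfV ?gt_eqF ?scale1r.
have yE : y = `|y| *: y' by rewrite scalerA mulfV ?gt_eqF ?scale1r.
clearbody x' y'.
have le_S : `|x + y| <= `|x| + `|y| - c * `|y| * `|x' - y'| ^+ 2.
  have -> : x + y = `|y| *: (x' + y') + (`|x| - `|y|) *: x'.
    by rewrite [in LHS]yE {1}xE scalerDr addrAC.
  apply: (le_trans (ler_normD _ _)).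
  rewrite !normrZ normr_id x'1 mulr1 ger0_norm ?subr_ge0//.
  have := unit_le _ _ x'1 y'1; rewrite -(ler_pM2l b0); lra.
have le_D : `|x - y| <= `|y| * `|x' - y'| + (`|x| - `|y|).
  have -> : x - y = `|y| *: (x' - y') + (`|x| - `|y|) *: x'.
    by rewrite [in LHS]yE {1}xE scalerBr addrAC.
  apply: (le_trans (ler_normD _ _)).
  by rewrite !normrZ normr_id x'1 mulr1 [`|_ - `|y| |]ger0_norm ?subr_ge0.
move: le_S le_D (normr_ge0 (x + y)) (normr_ge0 (x - y)) (normr_ge0 (x' - y')).
move: `|x + y| `|x - y| `|x' - y'| `|x| `|y| yx a0 b0.
move=> S D e a b ba a0 b0 le_S le_D S0 D0 e0.
(* Factor [(a + b)^2 - S^2]: one factor is at least [c b e^2], the other at least [a + b >= 2 b]. *)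
have S2 : S ^+ 2 <= (a + b) ^+ 2 - 2 * c * (b * e) ^+ 2.
  have : c * b * e ^+ 2 * (2 * b) <= (a + b - S) * (a + b + S).
    by apply: ler_pM; rewrite ?mulr_ge0 ?sqr_ge0 ?(ltW c0) ?(ltW b0)//; lra.
  lra.
have D2 : D ^+ 2 <= 2 * (b * e) ^+ 2 + 2 * (a - b) ^+ 2.
  have : D * D <= (b * e + (a - b)) * (b * e + (a - b)) by exact: ler_pM.
  have := sqr_ge0 (b * e - (a - b)); lra.
have := ler_wpM2l (ltW k0) D2.
have := ler_wpM2r (sqr_ge0 (b * e)) kc; have := ler_wpM2r (sqr_ge0 (a - b)) k2.
lra.
Qed.

(** The right side equals [2 |x|^2 + 2 |y|^2 - <x + y, xs> - <x + y, ys>]. Each pairing is at most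
    [|x + y|] times [|x|] or [|y|], and [|x + y| |x| <= |x|^2 + |x + y|^2 / 4]; half the
    parallelogram inequality concludes. *)
Lemma duality_strongly_monotone : two_uniformly_convex E ->
  exists2 k, 0 < k & forall x y xs ys, duality_set x xs -> duality_set y ys ->
    k * `|x - y| ^+ 2 <= pairing (x - y) (xs - ys).
Proof.
move=> /two_uniformly_convex_parallelogram[k k0 par]; exists (k / 2).
  by rewrite divr_gt0.
move=> x y xs ys /duality_setP[xx le_x] /duality_setP[yy le_y].
have := le_trans (ler_norm _) (le_x (x + y)).
have := le_trans (ler_norm _) (le_y (x + y)).
have := par x y.
rewrite pairingBr !pairingBl !pairingDl xx yy.
have := sqr_ge0 (`|x + y| - 2 * `|x|); have := sqr_ge0 (`|x + y| - 2 * `|y|).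
lra.
Qed.

End strong_monotonicity.

(** * Transfer of the Hoelder estimate to the resolvent *)

Theorem theorem3p4 (R : realType) (E : completeNormedModType R) (q : R)
    (C : set E) (A : set (E * dual E)) (r : R) :
  1 < q -> q <= 2 ->
  uniformly_smooth E q -> two_uniformly_convex E ->
  C !=set0 -> closed C -> convex_set C ->
  monotone_op A ->
  op_domain A `<=` C ->
  (forall s : R, 0 < s -> C `<=` @duality_map R E @^-1` range_J_plus A s) ->
  0 < r ->
  forall rho : R, 0 < rho ->
  exists L : R, forall x y : E, C x -> C y -> `|x| <= rho -> `|y| <= rho ->
    `|resolvent A r x - resolvent A r y| <= L * `|x - y| `^ (q - 1).
Proof.
move=> q1 q2 /uniformly_smooth_bound[K K0 smoothE].
move=> /duality_strongly_monotone[k k0 strong_mono] _ _ _ monoA _ CJ r0 rho _.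
(* Both [xget] choices are made from nonempty sets: by smoothness here, and by the range condition
   at [s = r] for the resolvent. *)
have dualityJ (x : E) : duality_set x (duality_map x).
  exact: (xgetPex 0 (duality_set_neq0 q1 (ltW K0) smoothE x)).
have resolventP (x : E) : C x -> resolvent_set A r x (resolvent A r x).
  move=> Cx; have [[z zs] /= Azs JzE] := CJ r r0 x Cx.
  by apply: (xgetPex 0); exists z, zs.
pose M := K * 2 `^ q * rho `^ (2 - q) + (2 * rho) `^ (2 - q).
exists (k^-1 * M) => x y Cx Cy xr yr.
have [->|xy] := eqVneq x y.
  by rewrite !subrr !normr0 powR0 ?mulr0// gt_eqF// subr_gt0.
have [us Au JxE] := resolventP x Cx; have [vs Av JyE] := resolventP y Cy.
move: (resolvent A r x) (resolvent A r y) Au JxE Av JyE => u v Au JxE Av JyE.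
have [->|uv] := eqVneq u v.
  rewrite subrr normr0 !mulr_ge0 ?powR_ge0 ?invr_ge0 ?(ltW k0)//.
  by rewrite addr_ge0 ?mulr_ge0 ?powR_ge0 ?(ltW K0).
have d0 : 0 < `|u - v| by rewrite normr_gt0 subr_eq0.
have JuE : duality_map u = duality_map x - r *: us by rewrite JxE addrK.
have JvE : duality_map v = duality_map y - r *: vs by rewrite JyE addrK.
have le_J : k * `|u - v| ^+ 2 <= pairing (u - v) (duality_map x - duality_map y).
  apply: (le_trans (strong_mono _ _ _ _ (dualityJ u) (dualityJ v))).
  have := ler_wpM2l (ltW r0) (monoA _ _ _ _ Au Av).
  rewrite JuE JvE !pairingBr !pairingZr; lra.
(* The Hoelder bound is tested on the unit vector along [u - v], so one factor [|u - v|] cancels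
   against the square in [le_J]. *)
have z1 : `| `|u - v|^-1 *: (u - v)| <= 1.
  by rewrite normrZ normfV normr_id mulVf ?gt_eqF.
have := duality_holder q1 q2 (ltW K0) smoothE xy xr yr z1 (dualityJ x) (dualityJ y).
rewrite pairingZl -/M ler_pdivrMl// => le_M.
rewrite -mulrA ler_pdivlMl// -(ler_pM2l d0) mulrCA -expr2.
exact: le_trans le_J le_M.
Qed.
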